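(* Let $r(x)=\sum_{n=0}^{\infty}x^{2^n-1}$, let $b$ be an indeterminate, and let $$r_b^{(1)}(x)=\frac{1+x^2+x^6+x^{14}+\cdots}{1+bx+bx^3+bx^7+bx^{15}+\cdots}=\frac{\sum_{j\ge1}x^{2^j-2}}{1+b\sum_{j\ge1}x^{2^j-1}}\in\mathbb{Z}[b][[x]].$$ Then the coefficient array of the expansion of $r_b^{(1)}(x)$, that is, the matrix whose $(n,k)$ entry ($n,k\ge 0$) is the coefficient of $b^k$ in the polynomial $[x^n]\,r_b^{(1)}(x)\in\mathbb{Z}[b]$, is the Riordan array $$\left(r(x^2),\,-x\,r(x^2)\right).$$
   Context: $[x^n]$ denotes extraction of the coefficient of $x^n$ in a power series. For power series $g(x)=g_0+g_1x+\cdots$ with $g_0\ne0$ and $f(x)=f_1x+f_2x^2+\cdots$ with $f_1\neq 0$, the Riordan array $(g(x),f(x))$ is the infinite matrix $(m_{n,k})_{n,k\ge0}$ with $m_{n,k}=[x^n]\,g(x)f(x)^k$. The series $r(x)=1+x+x^3+x^7+\cdots$ is the generating function of the Rueppel sequence. The series $r_b^{(1)}(x)$ arises from the generalized Rueppel generating function $b\,r(x)-(b-1)=1+b(x+x^3+x^7+\cdots)$ through the relation $b\,r(x)-(b-1)=\dfrac{1}{1-bx\,r_b^{(1)}(x)}$. *)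

(* Defs.v *)
(* boolp is used only to make power series an eqType/choiceType and
   to identify power series with equal coefficients. *)
From HB Require Import structures.
From mathcomp Require Import all_boot all_order all_algebra.
From mathcomp Require Import boolp.

Set Implicit Arguments.
Unset Strict Implicit.
Unset Printing Implicit Defensive.
Import GRing.Theory.
Local Open Scope ring_scope.

Record fps (R : Type) := Fps { fps_coef : nat -> R }.

HB.instance Definition _ (R : Type) := gen_eqMixin (fps R).
HB.instance Definition _ (R : Type) := gen_choiceMixin (fps R).

Lemma fpsP (R : Type) (f g : fps R) :
  (forall n, fps_coef f n = fps_coef g n) -> f = g.
Proof. by case: f g => [f] [g] /= /funext ->. Qed.

Section FpsRing.
Variable R : comNzRingType.
Implicit Types f g h : fps R.

Definition fps_zero : fps R := Fps (fun=> 0).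
Definition fps_opp f : fps R := Fps (fun n => - fps_coef f n).
Definition fps_add f g : fps R := Fps (fun n => fps_coef f n + fps_coef g n).

Lemma fps_addA : associative fps_add.
Proof. by move=> f g h; apply: fpsP => n /=; rewrite addrA. Qed.

Lemma fps_addC : commutative fps_add.
Proof. by move=> f g; apply: fpsP => n /=; rewrite addrC. Qed.

Lemma fps_add0 : left_id fps_zero fps_add.
Proof. by move=> f; apply: fpsP => n /=; rewrite add0r. Qed.

Lemma fps_addN : left_inverse fps_zero fps_opp fps_add.
Proof. by move=> f; apply: fpsP => n /=; rewrite addNr. Qed.

HB.instance Definition _ :=
  GRing.isZmodule.Build (fps R) fps_addA fps_addC fps_add0 fps_addN.

Definition fpsC (c : R) : fps R := Fps (fun n => c *+ (n == 0)%N).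
Definition fps_mul f g : fps R :=
  Fps (fun n => \sum_(i < n.+1) fps_coef f i * fps_coef g (n - i)).

Definition fps_trunc m f : {poly R} := \poly_(i < m) fps_coef f i.

Lemma coef_fps_trunc m f n : (n < m)%N -> (fps_trunc m f)`_n = fps_coef f n.
Proof. by move=> nm; rewrite coef_poly nm. Qed.

Lemma fps_mul_trunc m f g n : (n < m)%N ->
  fps_coef (fps_mul f g) n = (fps_trunc m f * fps_trunc m g)`_n.
Proof.
move=> nm; rewrite coefM; apply: eq_bigr => i _.
rewrite !coef_fps_trunc //; last by rewrite (leq_ltn_trans _ nm) // -ltnS.
exact: leq_ltn_trans (leq_subr _ _) nm.
Qed.

Lemma fps_mulC : commutative fps_mul.
Proof.
by move=> f g; apply: fpsP => n; rewrite !(fps_mul_trunc _ _ (ltnSn n)) mulrC.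
Qed.

Lemma fps_mulA : associative fps_mul.
Proof.
move=> f g h; apply: fpsP => n.
transitivity ((fps_trunc n.+1 f * (fps_trunc n.+1 g * fps_trunc n.+1 h))`_n).
  rewrite coefM; apply: eq_bigr => i _; rewrite coef_fps_trunc //.
  by rewrite (@fps_mul_trunc n.+1) // ltnS leq_subr.
rewrite mulrA coefM; apply: eq_bigr => i _.
by rewrite (@fps_mul_trunc n.+1) // coef_fps_trunc // ltnS leq_subr.
Qed.

Lemma fps_mul1 : left_id (fpsC 1) fps_mul.
Proof.
move=> f; apply: fpsP => n /=; rewrite big_ord_recl /= mul1r subn0.
by rewrite big1 ?addr0 // => i _; rewrite mul0r.
Qed.

Lemma fps_mulDl : left_distributive fps_mul fps_add.
Proof.
move=> f g h; apply: fpsP => n /=; rewrite -big_split /=.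
by apply: eq_bigr => i _; rewrite mulrDl.
Qed.

Lemma fps_oner_neq0 : fpsC 1 != 0.
Proof.
apply/eqP => /(congr1 (fun f => fps_coef f 0)) /= /eqP.
by rewrite oner_eq0.
Qed.

HB.instance Definition _ := GRing.Zmodule_isComNzRing.Build (fps R)
  fps_mulA fps_mulC fps_mul1 fps_mulDl fps_oner_neq0.

Lemma fps_coef0 n : fps_coef (0 : fps R) n = 0. Proof. by []. Qed.
Lemma fps_coef1 n : fps_coef (1 : fps R) n = (n == 0)%N%:R. Proof. by []. Qed.
Lemma fps_coefN f n : fps_coef (- f) n = - fps_coef f n. Proof. by []. Qed.
Lemma fps_coefD f g n : fps_coef (f + g) n = fps_coef f n + fps_coef g n.
Proof. by []. Qed.
Lemma fps_coefM f g n :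
  fps_coef (f * g) n = \sum_(i < n.+1) fps_coef f i * fps_coef g (n - i).
Proof. by []. Qed.

Lemma fps_coef_sum (I : Type) (s : seq I) (P : pred I) (F : I -> fps R) n :
  fps_coef (\sum_(i <- s | P i) F i) n = \sum_(i <- s | P i) fps_coef (F i) n.
Proof. by elim/big_rec2: _ => // i x y _ <-. Qed.

Definition fpsX : fps R := Fps (fun n => (n == 1)%N%:R).

(* The infinite sum of the F j; meaningful only when [x^n] F j = 0 for all
   n < j, so that the terms with j > n do not contribute to [x^n]. *)
Definition fps_sum (F : nat -> fps R) : fps R :=
  Fps (fun n => \sum_(j < n.+1) fps_coef (F j) n).

(* f(g(x)); meaningful only when g has zero constant term. *)
Definition fps_comp f g : fps R :=
  fps_sum (fun j => fpsC (fps_coef f j) * g ^+ j).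

Lemma fps_coefXn k n : fps_coef (fpsX ^+ k) n = (n == k)%N%:R.
Proof.
elim: k n => [|k IHk] n; first by rewrite expr0 fps_coef1.
rewrite exprS fps_coefM; case: n => [|n].
  by rewrite big_ord1 /= mul0r.
rewrite 2!big_ord_recl /= mul0r add0r mul1r subn1 /= IHk eqSS.
by rewrite big1 ?addr0 // => i _; rewrite mul0r.
Qed.

Lemma fps_coef_exp_lt f j n :
  fps_coef f 0 = 0 -> (n < j)%N -> fps_coef (f ^+ j) n = 0.
Proof.
move=> f0; elim: j n => // j IHj n nj; rewrite exprS fps_coefM.
rewrite big_ord_recl f0 mul0r add0r big1 // => i _.
rewrite IHj ?mulr0 // /bump /=.
by case: n nj i => [|n] nj i; [case: i|rewrite subSS (leq_ltn_trans (leq_subr _ _))].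
Qed.

End FpsRing.

Arguments fpsX {R}.

Section FpsUnit.
Variable R : comUnitRingType.
Implicit Types f g : fps R.

Definition fps_unit : {pred fps R} :=
  fun f => fps_coef f 0 \is a GRing.unit.

(* With c = f(0) and u = 1 - c^-1 f, which has zero constant term,
   1/f = c^-1 (1 + u + u^2 + ...). *)
Definition fps_inv f : fps R :=
  if fps_coef f 0 \is a GRing.unit then
    fpsC (fps_coef f 0)^-1 *
      fps_sum (fun j => (1 - fpsC (fps_coef f 0)^-1 * f) ^+ j)
  else f.

Lemma fps_mulV : {in fps_unit, left_inverse 1 fps_inv *%R}.
Proof.
move=> f fU; have f0U : fps_coef f 0 \is a GRing.unit by exact: fU.
rewrite /fps_inv f0U.
set c := fps_coef f 0; set u := 1 - fpsC c^-1 * f.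
have u0 : fps_coef u 0 = 0.
  by rewrite fps_coefD fps_coefN fps_coefM big_ord1 /= mulVr ?subrr.
rewrite -mulrA mulrCA.
have -> : fpsC c^-1 * f = 1 - u by rewrite /u opprB addrC subrK.
apply: fpsP => n.
transitivity (fps_coef ((\sum_(j < n.+1) u ^+ j) * (1 - u)) n).
  rewrite !fps_coefM; apply: eq_bigr => i _; congr (_ * _).
  rewrite fps_coef_sum [LHS]/=.
  rewrite (big_ord_widen n.+1 (fun j => fps_coef (u ^+ j) i)) //.
  rewrite big_mkcond; apply: eq_bigr => j _; case: ltnP => // ij.
  by rewrite fps_coef_exp_lt.
have -> : (\sum_(j < n.+1) u ^+ j) * (1 - u) = 1 - u ^+ n.+1.
  by rewrite -[1 - u ^+ _]opprB subrX1 mulrC -[1 - u]opprB mulNr.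
by rewrite fps_coefD fps_coefN (fps_coef_exp_lt u0) // subr0.
Qed.

Lemma fps_unitPl f g : g * f = 1 -> fps_unit f.
Proof.
move=> /(congr1 (fun h => fps_coef h 0)).
rewrite fps_coefM big_ord1 /= => gf1.
by apply/unitrPr; exists (fps_coef g 0); rewrite mulrC.
Qed.

Lemma fps_invr_out : {in [predC fps_unit], fps_inv =1 id}.
Proof. by move=> f /negPf f0U; rewrite /fps_inv ifF. Qed.

HB.instance Definition _ := GRing.ComNzRing_hasMulInverse.Build (fps R)
  fps_mulV fps_unitPl fps_invr_out.

End FpsUnit.

Definition is_riordan_array (R : comNzRingType)
    (M : nat -> nat -> R) (g f : fps R) : Prop :=
  [/\ fps_coef g 0 != 0,
      fps_coef f 0 = 0,
      fps_coef f 1 != 0 &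
      forall n k : nat, M n k = fps_coef (g * f ^+ k) n].

(* The exponents below dominate the summation index, as fps_sum requires. *)
Definition rueppel (R : comNzRingType) : fps R :=
  fps_sum (fun n => fpsX ^+ (2 ^ n - 1)).

(* The indeterminate b is 'X : {poly int}, and the sums over j >= 1 are
   reindexed by j = i.+1. *)
Definition rueppel_b1_num : fps {poly int} :=
  fps_sum (fun i => fpsX ^+ (2 ^ i.+1 - 2)).
Definition rueppel_b1_den : fps {poly int} :=
  1 + fpsC 'X * fps_sum (fun i => fpsX ^+ (2 ^ i.+1 - 1)).

Definition rueppel_b1 : fps {poly int} := rueppel_b1_num / rueppel_b1_den.

Lemma rueppel_b1_den_unit : rueppel_b1_den \is a GRing.unit.
Proof.
rewrite qualifE /= /in_mem /= /fps_unit fps_coefD fps_coef1 fps_coefM big_ord1.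
by rewrite [fps_coef (fps_sum _) _]big_ord1 fps_coefXn mulr0 addr0 unitr1.
Qed.

Lemma rueppel_b1E : rueppel_b1 * rueppel_b1_den = rueppel_b1_num.
Proof. by rewrite divrK ?rueppel_b1_den_unit. Qed.

(* Main.v *)
Require Import Defs.
From mathcomp Require Import all_boot all_order all_algebra.

Set Implicit Arguments.
Unset Strict Implicit.
Unset Printing Implicit Defensive.
Import GRing.Theory.
Local Open Scope ring_scope.

(** The bivariate generating function of a Riordan array $(g, f)$ is
    $\sum_k b^k g f^k = g / (1 - b f)$, so it suffices to recognise the given
    fraction as such a quotient.  With $g = r(x^2) = \sum_{i\ge0} x^{2^{i+1}-2}$
    the numerator is $g$ itself, and since
    $\sum_{i\ge0} x^{2^{i+1}-1} = x g$ the denominator is $1 + b x g = 1 - b f$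
    for $f = - x g$.

    The geometric series is never expanded.  If $B (1 - b f) = g$ with $f$, $g$
    free of $b$, then $B = g + b f B$; extracting the coefficient of $b^k$,
    which is linear over series free of $b$, turns this into the recursion
    $B_0 = g$, $B_{k+1} = f B_k$, whence $B_k = g f^k$
    ([bcoef_geometric]). *)

Definition fps_map (R S : Type) (h : R -> S) (F : fps R) : fps S :=
  Fps (fun n => h (fps_coef F n)).

Lemma fps_mapN (R S : comNzRingType) (h : {rmorphism R -> S}) (F : fps R) :
  fps_map h (- F) = - fps_map h F.
Proof. by apply: fpsP => n /=; rewrite rmorphN. Qed.

Lemma fps_mapM (R S : comNzRingType) (h : {rmorphism R -> S}) (F G : fps R) :
  fps_map h (F * G) = fps_map h F * fps_map h G.
Proof.
apply: fpsP => n /=; rewrite rmorph_sum.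
by apply: eq_bigr => i _; rewrite rmorphM.
Qed.

Lemma fps_mapX (R S : comNzRingType) (h : {rmorphism R -> S}) :
  fps_map h fpsX = fpsX.
Proof. by apply: fpsP => n /=; rewrite rmorph_nat. Qed.

Lemma fps_coefCM (R : comNzRingType) (c : R) (F : fps R) n :
  fps_coef (fpsC c * F) n = c * fps_coef F n.
Proof.
rewrite fps_coefM big_ord_recl /= subn0 big1 ?addr0 // => i _.
by rewrite mul0r.
Qed.

Lemma fps_coefXM (R : comNzRingType) (F : fps R) n :
  fps_coef (fpsX * F) n = if n is m.+1 then fps_coef F m else 0.
Proof.
rewrite fps_coefM; case: n => [|n]; first by rewrite big_ord1 mul0r.
rewrite 2!big_ord_recl /= mul0r add0r mul1r subSS subn0 big1 ?addr0 // => i _.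
by rewrite mul0r.
Qed.

Definition bcoef (R : comNzRingType) (k : nat) (B : fps {poly R}) : fps R :=
  Fps (fun n => (fps_coef B n)`_k).

Lemma bcoefD (R : comNzRingType) k (A B : fps {poly R}) :
  bcoef k (A + B) = bcoef k A + bcoef k B.
Proof. by apply: fpsP => n /=; rewrite coefD. Qed.

Lemma bcoef_map (R : comNzRingType) k (F : fps R) :
  bcoef k (fps_map polyC F) = if k == 0 then F else 0.
Proof. by apply: fpsP => n /=; rewrite coefC; case: eqP. Qed.

Lemma bcoef_mapM (R : comNzRingType) k (F : fps R) (B : fps {poly R}) :
  bcoef k (fps_map polyC F * B) = F * bcoef k B.
Proof.
by apply: fpsP => n /=; rewrite coef_sum; apply: eq_bigr => i _; rewrite coefCM.
Qed.

Lemma bcoef_bM (R : comNzRingType) k (B : fps {poly R}) :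
  bcoef k (fpsC 'X * B) = if k is k'.+1 then bcoef k' B else 0.
Proof.
apply: fpsP => n; transitivity (fps_coef (fpsC 'X * B) n)`_k => //.
by rewrite fps_coefCM coefXM; case: k.
Qed.

(** Reading $B = g + b f B$ at $b^{k+1}$, multiplication by $b$ lowers the index
    and $g$ contributes only at $k = 0$, so each column is $f$ times the
    preceding one. *)
Lemma bcoef_geometric (R : comNzRingType) (g f : fps R) (B : fps {poly R}) k :
  B * (1 - fpsC 'X * fps_map polyC f) = fps_map polyC g ->
  bcoef k B = g * f ^+ k.
Proof.
move=> eqB.
have {eqB} eqB : B = fps_map polyC g + fpsC 'X * (fps_map polyC f * B).
  by rewrite -eqB mulrBr mulr1 mulrA [B * _]mulrC subrK.
elim: k => [|k IHk]; rewrite eqB bcoefD bcoef_map bcoef_bM /=.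
  by rewrite addr0 mulr1.
by rewrite add0r bcoef_mapM IHk mulrCA exprS.
Qed.

(** The condition [i <= e i] makes [fps_sum] the full infinite sum, so that
    changing the cutoff on the index does not change a coefficient. *)
Lemma fps_coef_lacunary (R : comNzRingType) (e : nat -> nat) N n :
    (forall i, i <= e i)%N -> (n < N)%N ->
  fps_coef (fps_sum (fun i => fpsX ^+ e i) : fps R) n
    = \sum_(i < N) (n == e i)%:R.
Proof.
move=> le_e ltnN /=.
rewrite (big_ord_widen N (fun i => fps_coef (fpsX ^+ e i) n)) //.
rewrite big_mkcond; apply: eq_bigr => i _; rewrite fps_coefXn ltnS.
by case: leqP => // ltni; rewrite ltn_eqF // (leq_trans ltni).
Qed.

Lemma fps_map_lacunary (R S : comNzRingType) (h : {rmorphism R -> S})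
    (e : nat -> nat) :
  fps_map h (fps_sum (fun i => fpsX ^+ e i)) = fps_sum (fun i => fpsX ^+ e i).
Proof.
apply: fpsP => n; rewrite /= rmorph_sum; apply: eq_bigr => i _.
by rewrite !fps_coefXn rmorph_nat.
Qed.

Lemma fpsXM_lacunary (R : comNzRingType) (e : nat -> nat) :
    (forall i, i <= e i)%N ->
  fpsX * fps_sum (fun i => fpsX ^+ e i)
    = fps_sum (fun i => fpsX ^+ (e i).+1) :> fps R.
Proof.
move=> le_e; apply: fpsP => n; rewrite fps_coefXM.
have le_eS i : (i <= (e i).+1)%N by rewrite leqW.
rewrite (@fps_coef_lacunary _ (fun i => (e i).+1) n.+1) //.
case: n => [|n]; first by rewrite big1.
by rewrite (@fps_coef_lacunary _ _ n.+2).
Qed.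

(** In the double sum defining the coefficient of $x^n$, a given [i] contributes
    through the single index [j = e i], which is below the cutoff [n.+1]
    whenever [n = m * e i]. *)
Lemma fps_comp_lacunary (R : comNzRingType) (e : nat -> nat) m :
    (forall i, i <= e i)%N -> (0 < m)%N ->
  fps_comp (fps_sum (fun i => fpsX ^+ e i)) (fpsX ^+ m)
    = fps_sum (fun i => fpsX ^+ (m * e i)) :> fps R.
Proof.
move=> le_e m_gt0; apply: fpsP => n.
have le_em j : (j <= m * j)%N by rewrite leq_pmull.
rewrite (@fps_coef_lacunary _ _ n.+1) //; last first.
  by move=> i; apply: leq_trans (le_em _).
transitivity (\sum_(j < n.+1) \sum_(i < n.+1)
    (((j : nat) == e i)%:R * (n == m * j)%N%:R : R)).
  apply: eq_bigr => j _; rewrite fps_coefCM -exprM fps_coefXn.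
  by rewrite (@fps_coef_lacunary _ _ n.+1) // mulr_suml.
rewrite exchange_big /=; apply: eq_bigr => i _.
have [ne|nNe] := eqVneq n (m * e i)%N; last first.
  rewrite big1 // => j _.
  by case: eqP => [->|]; rewrite ?(negPf nNe) ?mulr0 ?mul0r.
have lt_ei : (e i < n.+1)%N by rewrite ltnS [leqRHS]ne.
rewrite (bigD1 (Ordinal lt_ei)) //= eqxx -ne eqxx mulr1 big1 ?addr0 // => j.
by rewrite -val_eqE /= => /negPf->; rewrite mul0r.
Qed.

Lemma leq_exp2B1 i : (i <= 2 ^ i - 1)%N.
Proof.
by have := ltn_expl i (isT : 1 < 2)%N; case: (2 ^ i)%N => // p; rewrite subn1.
Qed.

Lemma exp2S_B2 i : (2 ^ i.+1 - 2 = 2 * (2 ^ i - 1))%N.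
Proof. by rewrite mulnBr expnS. Qed.

Lemma exp2S_B1 i : (2 ^ i.+1 - 1 = (2 ^ i.+1 - 2).+1)%N.
Proof. by rewrite -subSn ?subSS // expnS leq_pmulr ?expn_gt0. Qed.

Lemma leq_exp2SB2 i : (i <= 2 ^ i.+1 - 2)%N.
Proof. by rewrite exp2S_B2 (leq_trans (leq_exp2B1 i)) ?leq_pmull. Qed.

Lemma rueppel_comp_sq (R : comNzRingType) :
  fps_comp (rueppel R) (fpsX ^+ 2) = fps_sum (fun i => fpsX ^+ (2 ^ i.+1 - 2)).
Proof.
rewrite fps_comp_lacunary //; last exact: leq_exp2B1.
by apply: fpsP => n; apply: eq_bigr => i _; rewrite exp2S_B2.
Qed.

Lemma rueppel_b1_numE :
  rueppel_b1_num = fps_map polyC (fps_comp (rueppel int) (fpsX ^+ 2)).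
Proof. by rewrite rueppel_comp_sq fps_map_lacunary. Qed.

(** The sum in the denominator has exponents $2^{i+1}-1$, those of the numerator
    shifted by one: it is $x$ times the numerator. *)
Lemma rueppel_b1_denE :
  rueppel_b1_den =
    1 - fpsC 'X *
      fps_map polyC (- (fpsX * fps_comp (rueppel int) (fpsX ^+ 2))).
Proof.
rewrite fps_mapN fps_mapM fps_mapX -rueppel_b1_numE mulrN opprK.
congr (1 + _ * _); rewrite fpsXM_lacunary; last exact: leq_exp2SB2.
by apply: fpsP => n; apply: eq_bigr => i _; rewrite exp2S_B1.
Qed.

Theorem proposition19 :
  is_riordan_array
    (fun n k : nat => (fps_coef rueppel_b1 n)`_k : int)
    (fps_comp (rueppel int) (fpsX ^+ 2))
    (- (fpsX * fps_comp (rueppel int) (fpsX ^+ 2))).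
Proof.
have g0 : fps_coef (fps_comp (rueppel int) (fpsX ^+ 2)) 0 = 1.
  by rewrite rueppel_comp_sq [LHS]big_ord1 fps_coefXn.
split.
- by rewrite g0.
- by rewrite fps_coefN fps_coefXM oppr0.
- by rewrite fps_coefN fps_coefXM g0.
move=> n k; rewrite -(@bcoef_geometric _ _ _ rueppel_b1) //.
by rewrite -rueppel_b1_denE -rueppel_b1_numE rueppel_b1E.
Qed.
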